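(* If $\Gamma\vdash M:A$ is derivable in $\lambda$A and $M\to_\beta L$ (one-step $\beta$-reduction, anywhere inside $M$), then $\Gamma\vdash L:A$ is also derivable in $\lambda$A.
   Context: Type expressions: fix a countably infinite set of type variables $X,Y,Z,\dots$. Pseudo type expressions are generated by $A::=X\mid A\to A\mid \bullet A\mid \mu X.A$ ($\mu$ binds $X$; $\alpha$-convertible expressions are identified; $\to$ associates to the right; $\bullet$ binds tighter than $\to$, which binds tighter than $\mu$). $A[B/X]$ denotes capture-avoiding substitution. $\top$ abbreviates $\mu X.\bullet X$, and $\bullet^n A$ denotes $A$ prefixed by $n$ copies of $\bullet$. The tail $t(A)$ is defined by $t(X)=X$, $t(A\to B)=t(B)$, $t(\bullet A)=\bullet t(A)$, $t(\mu X.A)=\mu X.t(A)$; it always has the form $\bullet^{m_0}\mu X_1.\bullet^{m_1}\mu X_2.\cdots\mu X_n.\bullet^{m_n}Y$. $A$ is a $\top$-variant iff $Y=X_i$ for some $1\le i\le n$ with $X_i\notin\{X_{i+1},\dots,X_n\}$ and $m_i+\dots+m_n\ge 1$. $A$ is proper in $X$ iff: a variable $Y$ is proper in $X$ iff $Y\neq X$; $\bullet A$ is always proper in $X$; $A\to B$ is proper in $X$ iff both $A,B$ are proper in $X$ or $B$ is a $\top$-variant; for $Y\ne X$, $\mu Y.A$ is proper in $X$ iff $A$ is proper in $X$ or $\mu Y.A$ is a $\top$-variant. Type expressions are the least set of pseudo type expressions containing all type variables, closed under $\to$ and $\bullet$, and containing $\mu X.A$ whenever it contains $A$ and $A$ is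 proper in $X$. Equality: $\cong$ is the least relation on type expressions such that: $A\cong A$; $A\cong B$ implies $B\cong A$; $A\cong B$ and $B\cong C$ imply $A\cong C$; $A\cong B$ implies $\bullet A\cong\bullet B$; $A\cong C$ and $B\cong D$ imply $A\to B\cong C\to D$; $A\to\top\cong\top$; $\mu X.A\cong A[\mu X.A/X]$; and if $A\cong C[A/X]$ with $C$ proper in $X$, then $A\cong\mu X.C$. $\simeq$ is the least relation satisfying the same closure conditions and additionally $\bullet(A\to B)\simeq\bullet A\to\bullet B$. Subtyping: a subtyping assumption $\gamma$ is a finite set of pairs $X\preceq Y$ of type variables in which each type variable occurs at most once; $FTV(\gamma)$ is the set of variables occurring in it. Judgments $\gamma\vdash A\preceq B$ are derived by the rules: $\gamma\cup\{X\preceq Y\}\vdash X\preceq Y$; $\gamma\vdash A\preceq\top$; from $A\simeq B$ infer $\gamma\vdash A\preceq B$; from $\gamma_1\vdash A\preceq B$ and $\gamma_2\vdash B\preceq C$ infer $\gamma_1\cup\gamma_2\vdash A\preceq C$; from $\gamma\vdash A\preceq B$ infer $\gamma\vdash\bullet A\preceq\bullet B$; from $\gamma_1\vdash A'\preceq A$ and $\gamma_2\vdash B\preceq B'$ infer $\gamma_1\cup\gamma_2\vdash A\to B\preceq A'\to B'$; from $\gamma\cup\{X\preceq Y\}\vdash A\preceq B$ infer $\gamma\vdash\mu X.A\preceq\mu Y.B$, provided $X\notin FTV(\gamma)\cup FTV(B)$, $Y\notin FTV(\gamma)\cup FTV(A)$, $A$ is proper in $X$ and $B$ is proper in $Y$;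 and $\gamma\vdash A\preceq\bullet A$. All sets $\gamma\cup\{X\preceq Y\}$, $\gamma_1\cup\gamma_2$ must be well-formed subtyping assumptions. $A\preceq B$ means $\{\}\vdash A\preceq B$ is derivable. Typing system $\lambda$A: untyped $\lambda$-terms $M::=x\mid\lambda x.M\mid MM$ (identified up to $\alpha$-conversion). A typing context $\Gamma$ is a finite map from individual variables to type expressions, written $\{x_1:A_1,\dots,x_n:A_n\}$; $\bullet\Gamma$ is $\{x_1:\bullet A_1,\dots,x_n:\bullet A_n\}$; unions of contexts must be well-formed (a variable receives at most one type). Rules: (var) $\Gamma\cup\{x:A\}\vdash x:A$; (shift) from $\bullet\Gamma\vdash M:\bullet A$ infer $\Gamma\vdash M:A$; ($\top$) $\Gamma\vdash M:\top$; ($\preceq$) from $\Gamma\vdash M:A$ and $A\preceq B$ infer $\Gamma\vdash M:B$; ($\to$I) from $\Gamma\cup\{x:A\}\vdash M:B$ infer $\Gamma\vdash\lambda x.M:A\to B$; ($\to$E) from $\Gamma_1\vdash M:A\to B$ and $\Gamma_2\vdash N:A$ infer $\Gamma_1\cup\Gamma_2\vdash MN:B$. *)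

(* Defs.v *)
(* Locally nameless representation of types and terms:
   named free variables (nat), de Bruijn indices for bound variables.
   alpha-equivalent expressions therefore have the same representation. *)
From Stdlib Require Import List Arith.
Import ListNotations.

Inductive ty : Type :=
| TFVar  : nat -> ty
| TBVar  : nat -> ty
| TArr   : ty -> ty -> ty
| TLater : ty -> ty
| TMu    : ty -> ty.

Fixpoint ty_open_rec (k : nat) (U : ty) (A : ty) : ty :=
  match A with
  | TFVar x => TFVar x
  | TBVar n => if Nat.eqb k n then U else TBVar n
  | TArr A1 A2 => TArr (ty_open_rec k U A1) (ty_open_rec k U A2)
  | TLater A1 => TLater (ty_open_rec k U A1)
  | TMu A1 => TMu (ty_open_rec (S k) U A1)
  end.

Definition ty_open (A U : ty) : ty := ty_open_rec 0 U A.

Fixpoint ty_fv (A : ty) : list nat :=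
  match A with
  | TFVar x => [x]
  | TBVar _ => []
  | TArr A1 A2 => ty_fv A1 ++ ty_fv A2
  | TLater A1 => ty_fv A1
  | TMu A1 => ty_fv A1
  end.

Definition top : ty := TMu (TLater (TBVar 0)).

(* The tail t(A) = bullet^{m0} mu X1. bullet^{m1} ... mu Xn. bullet^{mn} Y
   is recorded as its spine (true = bullet, false = mu) and final variable. *)
Fixpoint tail_spine (A : ty) : list bool :=
  match A with
  | TFVar _ | TBVar _ => []
  | TArr _ B => tail_spine B
  | TLater A1 => true :: tail_spine A1
  | TMu A1 => false :: tail_spine A1
  end.

Fixpoint tail_var (A : ty) : ty :=
  match A with
  | TFVar x => TFVar x
  | TBVar n => TBVar n
  | TArr _ B => tail_var B
  | TLater A1 => tail_var A1
  | TMu A1 => tail_var A1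
  end.

(* [tv_check l j b]: l is the reversed spine (innermost first); j is the de
   Bruijn index of the final variable; b records whether a bullet has been
   seen after (i.e. inside) the current position.  Succeeds iff the final
   variable is bound by the spine binder mu X_i (the last binder with that
   name) and m_i + ... + m_n >= 1. *)
Fixpoint tv_check (l : list bool) (j : nat) (b : bool) : bool :=
  match l with
  | [] => false
  | true :: l' => tv_check l' j true
  | false :: l' => match j with
                   | 0 => b
                   | S j' => tv_check l' j' b
                   end
  end.

Definition top_variant (A : ty) : Prop :=
  match tail_var A with
  | TBVar j => tv_check (rev (tail_spine A)) j false = true
  | _ => False
  end.

Fixpoint proper (X : nat) (A : ty) : Prop :=
  match A with
  | TFVar Y => Y <> X
  | TBVar _ => True            (* bound variables are distinct from X *)
  | TLater _ => True
  | TArr A1 B1 => (proper X A1 /\ proper X B1) \/ top_variant B1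
  | TMu A1 => proper X A1 \/ top_variant (TMu A1)
  end.

Inductive is_type : ty -> Prop :=
| it_var : forall x, is_type (TFVar x)
| it_arr : forall A B, is_type A -> is_type B -> is_type (TArr A B)
| it_later : forall A, is_type A -> is_type (TLater A)
| it_mu : forall A X, ~ In X (ty_fv A) ->
    is_type (ty_open A (TFVar X)) -> proper X (ty_open A (TFVar X)) ->
    is_type (TMu A).

(* ---------- equality of types ----------
   teq false = the relation ≅ ; teq true = the relation ≃ (with the extra
   axiom bullet(A -> B) ≃ bullet A -> bullet B).  Relations on type
   expressions: base axioms require their instances to be type expressions. *)
Inductive teq (d : bool) : ty -> ty -> Prop :=
| teq_refl : forall A, is_type A -> teq d A A
| teq_sym : forall A B, teq d A B -> teq d B A
| teq_trans : forall A B C, teq d A B -> teq d B C -> teq d A C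
| teq_later : forall A B, teq d A B -> teq d (TLater A) (TLater B)
| teq_arr : forall A B C D, teq d A C -> teq d B D ->
    teq d (TArr A B) (TArr C D)
| teq_top : forall A, is_type A -> teq d (TArr A top) top
| teq_unfold : forall A, is_type (TMu A) -> teq d (TMu A) (ty_open A (TMu A))
| teq_fix : forall A C X, ~ In X (ty_fv C) ->
    is_type (ty_open C (TFVar X)) -> proper X (ty_open C (TFVar X)) ->
    teq d A (ty_open C A) -> teq d A (TMu C)
| teq_distr : forall A B, d = true -> is_type A -> is_type B ->
    teq d (TLater (TArr A B)) (TArr (TLater A) (TLater B)).

Definition ty_cong := teq false.
Definition ty_sim := teq true.

(* A subtyping assumption is a set of pairs X ⪯ Y of type variables. *)
Definition sassm := nat -> nat -> Prop.

Definition sassm_empty : sassm := fun _ _ => False.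
Definition sassm_single (X Y : nat) : sassm := fun X' Y' => X' = X /\ Y' = Y.
Definition sassm_union (g1 g2 g : sassm) : Prop :=
  forall X Y, g X Y <-> g1 X Y \/ g2 X Y.
Definition sassm_wf (g : sassm) : Prop :=
  (forall X Y, g X Y -> X <> Y) /\
  (forall X Y X' Y', g X Y -> g X' Y' ->
     (X = X' \/ X = Y' \/ Y = X' \/ Y = Y') -> X = X' /\ Y = Y').
Definition in_FTV (Z : nat) (g : sassm) : Prop :=
  exists W, g Z W \/ g W Z.

Inductive sub : sassm -> ty -> ty -> Prop :=
| sub_assm : forall g X Y, sassm_wf g -> g X Y -> sub g (TFVar X) (TFVar Y)
| sub_top : forall g A, sassm_wf g -> is_type A -> sub g A top
| sub_sim : forall g A B, sassm_wf g -> ty_sim A B -> sub g A B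
| sub_trans : forall g1 g2 g A B C, sub g1 A B -> sub g2 B C ->
    sassm_union g1 g2 g -> sassm_wf g -> sub g A C
| sub_later : forall g A B, sub g A B -> sub g (TLater A) (TLater B)
| sub_arr : forall g1 g2 g A A' B B', sub g1 A' A -> sub g2 B B' ->
    sassm_union g1 g2 g -> sassm_wf g -> sub g (TArr A B) (TArr A' B')
| sub_mu : forall g g' A B X Y,
    ~ In X (ty_fv A) -> ~ In Y (ty_fv B) ->
    sassm_union g (sassm_single X Y) g' -> sassm_wf g' ->
    sub g' (ty_open A (TFVar X)) (ty_open B (TFVar Y)) ->
    ~ in_FTV X g -> ~ In X (ty_fv (ty_open B (TFVar Y))) ->
    ~ in_FTV Y g -> ~ In Y (ty_fv (ty_open A (TFVar X))) ->
    proper X (ty_open A (TFVar X)) -> proper Y (ty_open B (TFVar Y)) ->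
    sub g (TMu A) (TMu B)
| sub_next : forall g A, sassm_wf g -> is_type A -> sub g A (TLater A).

Definition subtype (A B : ty) : Prop := sub sassm_empty A B.

Inductive tm : Type :=
| fvar : nat -> tm
| bvar : nat -> tm
| lam : tm -> tm
| app : tm -> tm -> tm.

Fixpoint tm_open_rec (k : nat) (u : tm) (t : tm) : tm :=
  match t with
  | fvar x => fvar x
  | bvar n => if Nat.eqb k n then u else bvar n
  | lam t1 => lam (tm_open_rec (S k) u t1)
  | app t1 t2 => app (tm_open_rec k u t1) (tm_open_rec k u t2)
  end.

Definition tm_open (t u : tm) : tm := tm_open_rec 0 u t.

Fixpoint tm_fv (t : tm) : list nat :=
  match t with
  | fvar x => [x]
  | bvar _ => []
  | lam t1 => tm_fv t1
  | app t1 t2 => tm_fv t1 ++ tm_fv t2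
  end.

(* locally closed terms = (alpha-classes of) ordinary lambda terms *)
Inductive lc : tm -> Prop :=
| lc_var : forall x, lc (fvar x)
| lc_lam : forall t x, ~ In x (tm_fv t) -> lc (tm_open t (fvar x)) -> lc (lam t)
| lc_app : forall t1 t2, lc t1 -> lc t2 -> lc (app t1 t2).

Inductive beta : tm -> tm -> Prop :=
| beta_red : forall t u, lc (lam t) -> lc u -> beta (app (lam t) u) (tm_open t u)
| beta_app1 : forall t t' u, beta t t' -> lc u -> beta (app t u) (app t' u)
| beta_app2 : forall t u u', lc t -> beta u u' -> beta (app t u) (app t u')
| beta_lam : forall t t' x, ~ In x (tm_fv t) -> ~ In x (tm_fv t') ->
    beta (tm_open t (fvar x)) (tm_open t' (fvar x)) -> beta (lam t) (lam t').

Definition ctx := nat -> option ty.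

Definition typing_context (G : ctx) : Prop :=
  (exists n, forall x, n <= x -> G x = None) /\
  (forall x A, G x = Some A -> is_type A).

Definition ctx_single (x : nat) (A : ty) : ctx :=
  fun y => if Nat.eqb y x then Some A else None.
(* G = G1 ∪ G2 (well-formedness is automatic since G is a function) *)
Definition ctx_union (G1 G2 G : ctx) : Prop :=
  forall x A, G x = Some A <-> G1 x = Some A \/ G2 x = Some A.
Definition ctx_later (G : ctx) : ctx :=
  fun x => option_map TLater (G x).

Inductive typed : ctx -> tm -> ty -> Prop :=
| T_var : forall G x A, G x = Some A -> typed G (fvar x) A
| T_shift : forall G M A, typed (ctx_later G) M (TLater A) -> typed G M A
| T_top : forall G M, lc M -> typed G M top
| T_sub : forall G M A B, typed G M A -> subtype A B -> typed G M B
| T_abs : forall G G' M A B x, ~ In x (tm_fv M) -> is_type A ->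
    ctx_union G (ctx_single x A) G' ->
    typed G' (tm_open M (fvar x)) B -> typed G (lam M) (TArr A B)
| T_app : forall G1 G2 G M N A B, typed G1 M (TArr A B) -> typed G2 N A ->
    ctx_union G1 G2 G -> typed G (app M N) B.

(* Main.v *)
(** Every type expression either has a [top]-variant tail, and is then equal to
    [top], or unfolds to a head form: a variable, or an arrow once the bullets in
    front of it are pushed inside. Both alternatives are invariant under equality
    and monotone under subtyping, so that [A -> B <= C -> D] yields, unless [D] is
    [top], some [k] with [C <= .^k A] and [.^k B <= D].

    For a redex, [G |- lam M : A -> B] comes from [.^n G, x : C |- M : D] with
    [C -> D <= .^n A -> .^n B]. Delaying the latter derivation [k] times gives
    [x] the type [.^k C], which the argument has in [.^n G]; the other variables
    need only [E <= .^k E]. Substitution then types the contractum with [.^n B]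
    in [.^n G], and [n] shifts remove the bullets. *)

From Stdlib Require Import List Arith Lia.
Require Import Defs.
Import ListNotations.

#[local] Hint Resolve it_var it_arr it_later : core.
#[local] Hint Resolve teq_refl teq_later teq_arr teq_distr : core.
#[local] Hint Immediate teq_sym : core.

(** Transitivity and the fixed-point rule can route a derivation between two arrows through
    arbitrary intermediate types, so subtyping cannot be inverted rule by rule: an invariant must
    survive every rule. Treating [top] apart is forced by [A -> top = top]: [top] has no head form,
    yet it equals arrows. The number [k] originates in [A <= .A], which at an arrow reads
    [A -> B <= .A -> .B]; transitivity adds such delays. The number [n] counts the shift rules
    passed after the abstraction rule. The hardest case is the mu rule of subtyping, whose premise
    compares bodies under an assumption [X <= Y]. Substituting the two recursive types for [X] and
    [Y] at once turns this assumption into the conclusion of the rule, so subtyping has to be closed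
    under substitutions that respect the assumptions. Heads found under the binders survive this
    substitution unless they are the bound variables, and a bound variable at the head makes the
    recursive type equal to [top]. *)

Lemma exists_fresh (l : list nat) : exists x, forall y, In y l -> y < x.
Proof.
  induction l as [|a l [x IH]].
  - exists 0. simpl; tauto.
  - exists (S (a + x)). intros y [<-|Hy]; [lia|]. specialize (IH _ Hy); lia.
Qed.

Definition update {T : Type} (s : nat -> T) (x : nat) (u : T) : nat -> T :=
  fun y => if Nat.eqb y x then u else s y.

Lemma update_eq {T : Type} (s : nat -> T) (x : nat) (u : T) : update s x u x = u.
Proof. unfold update. now rewrite Nat.eqb_refl. Qed.

Lemma update_neq {T : Type} (s : nat -> T) (x y : nat) (u : T) :
  y <> x -> update s x u y = s y.
Proof. intros H. unfold update. now apply Nat.eqb_neq in H as ->. Qed.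

(** * Substitution in types *)

(** Simultaneous, because the mu rule of subtyping calls for replacing two bound variables at
    once. *)
Fixpoint ty_subst (s : nat -> ty) (A : ty) : ty :=
  match A with
  | TFVar x => s x
  | TBVar n => TBVar n
  | TArr A1 A2 => TArr (ty_subst s A1) (ty_subst s A2)
  | TLater A1 => TLater (ty_subst s A1)
  | TMu A1 => TMu (ty_subst s A1)
  end.

Fixpoint ty_closed (k : nat) (A : ty) : Prop :=
  match A with
  | TFVar _ => True
  | TBVar n => n < k
  | TArr A1 A2 => ty_closed k A1 /\ ty_closed k A2
  | TLater A1 => ty_closed k A1
  | TMu A1 => ty_closed (S k) A1
  end.

Lemma ty_closed_open_inv (A U : ty) : forall k,
  ty_closed k (ty_open_rec k U A) -> ty_closed (S k) A.
Proof.
  induction A; simpl; intros k H; auto; try tauto.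
  - destruct (Nat.eqb_spec k n); simpl in H; lia.
  - destruct H; split; auto.
Qed.

Lemma is_type_closed (A : ty) : is_type A -> ty_closed 0 A.
Proof.
  induction 1; simpl; auto. eapply ty_closed_open_inv; eassumption.
Qed.

Lemma ty_open_closed (A U : ty) : forall j k,
  ty_closed j A -> j <= k -> ty_open_rec k U A = A.
Proof.
  induction A; simpl; intros j k H Hjk; auto.
  - destruct (Nat.eqb_spec k n); auto; lia.
  - destruct H; f_equal; eauto.
  - f_equal; eauto.
  - f_equal. eapply IHA; [eassumption|lia].
Qed.

Lemma ty_subst_open_rec (s : nat -> ty) (A U : ty) :
  (forall x, ty_closed 0 (s x)) -> forall k,
  ty_subst s (ty_open_rec k U A) = ty_open_rec k (ty_subst s U) (ty_subst s A).
Proof.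
  intros Hs; induction A; simpl; intros k; auto; try (f_equal; auto; fail).
  - symmetry. eapply ty_open_closed; [apply Hs|lia].
  - destruct (Nat.eqb k n); auto.
Qed.

Lemma ty_subst_ext (s t : nat -> ty) (A : ty) :
  (forall x, In x (ty_fv A) -> s x = t x) -> ty_subst s A = ty_subst t A.
Proof.
  induction A; simpl; intros H; auto; f_equal; auto;
    [apply IHA1|apply IHA2]; intros; apply H, in_or_app; auto.
Qed.

Lemma ty_subst_id (A : ty) : ty_subst TFVar A = A.
Proof. induction A; simpl; congruence. Qed.

Lemma in_fv_ty_subst (s : nat -> ty) (A : ty) (y z : nat) :
  In y (ty_fv A) -> In z (ty_fv (s y)) -> In z (ty_fv (ty_subst s A)).
Proof.
  induction A; simpl; intros Hy Hz; auto; try tauto.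
  - destruct Hy as [->|[]]; auto.
  - apply in_app_or in Hy. apply in_or_app. tauto.
Qed.

Lemma in_fv_ty_open_rec (A U : ty) (x : nat) : forall k,
  In x (ty_fv (ty_open_rec k U A)) -> In x (ty_fv A) \/ In x (ty_fv U).
Proof.
  induction A; simpl; intros k H; auto.
  - destruct (Nat.eqb k n); auto.
  - apply in_app_or in H. rewrite in_app_iff.
    destruct H as [H|H]; [apply IHA1 in H|apply IHA2 in H]; tauto.
  - eauto.
  - eauto.
Qed.

Lemma in_fv_ty_open (A U : ty) (x : nat) :
  In x (ty_fv (ty_open A U)) -> In x (ty_fv A) \/ In x (ty_fv U).
Proof. apply in_fv_ty_open_rec. Qed.

Lemma in_fv_ty_open_r (A U : ty) (x : nat) : forall k,
  In x (ty_fv A) -> In x (ty_fv (ty_open_rec k U A)).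
Proof.
  induction A; simpl; intros k H; auto; try tauto.
  rewrite in_app_iff in *. destruct H; auto.
Qed.

(** The rules for [TMu] speak of one fresh name [X] only; this identity carries what is known for
    that name over to any other name or type. *)
Lemma ty_subst_open_update (s : nat -> ty) (A U : ty) (X : nat) :
  (forall x, ty_closed 0 (s x)) -> ty_closed 0 U -> ~ In X (ty_fv A) ->
  ty_subst (update s X U) (ty_open A (TFVar X)) = ty_open (ty_subst s A) U.
Proof.
  intros Hs HU HX. unfold ty_open. rewrite ty_subst_open_rec.
  - simpl. rewrite update_eq. f_equal. apply ty_subst_ext.
    intros y Hy. apply update_neq. intros ->; auto.
  - intros y. unfold update. destruct (Nat.eqb y X); auto.
Qed.

Lemma ty_subst_open_single (A U : ty) (X : nat) :
  ty_closed 0 U -> ~ In X (ty_fv A) ->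
  ty_subst (update TFVar X U) (ty_open A (TFVar X)) = ty_open A U.
Proof.
  intros HU HX. rewrite ty_subst_open_update; auto.
  - now rewrite ty_subst_id.
  - intros; exact I.
Qed.

(** * Tails *)

(* [Free n x] and [Bound n j] stand for a tail with [n] bullets in front of a
   free variable, resp. of a de Bruijn index dangling at the current depth;
   [Junk] arises only from the tail [mu X. X], which no type expression has. *)
Inductive tail : Type :=
| Top : tail
| Free : nat -> nat -> tail
| Bound : nat -> nat -> tail
| Junk : tail.

Definition delay (n : nat) (t : tail) : tail :=
  match t with
  | Free m x => Free (n + m) x
  | Bound m j => Bound (n + m) j
  | _ => t
  end.

(** At index 0 this is the condition for a variant of [top]: the final variable belongs to this
    binder and at least one bullet lies inside it. *)
Definition bind (t : tail) : tail :=
  match t with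
  | Bound 0 0 => Junk
  | Bound (S _) 0 => Top
  | Bound n (S j) => Bound n j
  | _ => t
  end.

Fixpoint tail_of (A : ty) : tail :=
  match A with
  | TFVar x => Free 0 x
  | TBVar j => Bound 0 j
  | TArr _ B => tail_of B
  | TLater A1 => delay 1 (tail_of A1)
  | TMu A1 => bind (tail_of A1)
  end.

(** A constructor added outside [A] lands at the end of the reversed spine, so quantifying over the
    suffix [l] makes structural induction work. A pending tail records the state of [tv_check] on
    reaching [l]: the remaining index, and whether a bullet was met. *)
Lemma tail_of_spine (A : ty) :
  match tail_of A with
  | Top => exists j, tail_var A = TBVar j /\
      forall l, tv_check (rev (tail_spine A) ++ l) j false = true
  | Free _ x => tail_var A = TFVar x
  | Bound n j' => exists j, tail_var A = TBVar j /\
      forall l, tv_check (rev (tail_spine A) ++ l) j false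
                = tv_check l j' (Nat.ltb 0 n)
  | Junk => exists j, tail_var A = TBVar j /\
      forall l, tv_check (rev (tail_spine A) ++ l) j false = false
  end.
Proof.
  induction A; simpl; auto.
  - exists n. auto.
  - destruct (tail_of A); simpl; auto; destruct IHA as [j [Hj H]];
      exists j; split; auto; intros l; rewrite <- app_assoc; rewrite H; auto.
  - destruct (tail_of A) as [|n x|[|n] [|j']|]; simpl; auto;
      destruct IHA as [j [Hj H]];
      exists j; split; auto; intros l; rewrite <- app_assoc; rewrite H; auto.
Qed.

Lemma top_variant_tail (A : ty) : top_variant A <-> tail_of A = Top.
Proof.
  unfold top_variant. pose proof (tail_of_spine A) as H.
  destruct (tail_of A) as [|n x|n j'|].
  - destruct H as [j [-> H]]. specialize (H []). rewrite app_nil_r in H. tauto.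
  - rewrite H. split; [tauto|discriminate].
  - destruct H as [j [-> H]]. specialize (H []). rewrite app_nil_r in H.
    simpl in H. rewrite H. split; discriminate.
  - destruct H as [j [-> H]]. specialize (H []). rewrite app_nil_r in H.
    rewrite H. split; discriminate.
Qed.

(** This consequence of properness is what keeps [bind] from producing [Junk]. *)
Lemma proper_tail (X : nat) (A : ty) : proper X A -> tail_of A <> Free 0 X.
Proof.
  induction A; simpl; intros H; try discriminate.
  - congruence.
  - destruct H as [[_ H]|H]; auto. apply top_variant_tail in H. congruence.
  - destruct (tail_of A); simpl; discriminate.
  - destruct H as [H|H].
    + specialize (IHA H). destruct (tail_of A) as [|?|[|n] [|j']|]; simpl; auto; discriminate.
    + apply top_variant_tail in H. simpl in H. congruence.
Qed.

Definition finished (t : tail) : Prop :=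
  match t with Top | Free _ _ => True | _ => False end.

Lemma tail_open_rec_var (A : ty) (x : nat) : forall k,
  tail_of (ty_open_rec k (TFVar x) A) =
  match tail_of A with
  | Bound n j => if Nat.eqb k j then Free n x else Bound n j
  | t => t
  end.
Proof.
  induction A; simpl; intros k; auto.
  - destruct (Nat.eqb k n); auto.
  - rewrite IHA. destruct (tail_of A); simpl; auto. destruct (Nat.eqb k n0); auto.
  - rewrite IHA. destruct (tail_of A) as [|?|[|n] [|j']|]; simpl; auto;
      destruct (Nat.eqb k j'); auto.
Qed.

(** Under [TMu], opening turns a tail at index 0 into a tail at [X]; properness puts a bullet in
    front of it, so [bind] yields [Top]. *)
Lemma is_type_tail (A : ty) : is_type A -> finished (tail_of A).
Proof.
  induction 1 as [| | |A X HX HA IH HP]; simpl; auto.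
  - destruct (tail_of A); simpl in *; auto.
  - apply proper_tail in HP. unfold ty_open in *. rewrite tail_open_rec_var in *.
    destruct (tail_of A) as [|?|[|n] [|j']|]; simpl in *; auto.
Qed.

Lemma tail_free_in_fv (A : ty) (n x : nat) :
  tail_of A = Free n x -> In x (ty_fv A).
Proof.
  revert n; induction A; simpl; intros m H; try discriminate.
  - injection H; auto.
  - apply in_or_app; eauto.
  - destruct (tail_of A); simpl in H; try discriminate.
    injection H as _ ->; eauto.
  - destruct (tail_of A) as [|?|[|?] [|?]|]; simpl in H; try discriminate.
    injection H as -> ->; eauto.
Qed.

Lemma tail_mu (A : ty) (X : nat) :
  ~ In X (ty_fv A) -> is_type (ty_open A (TFVar X)) ->
  proper X (ty_open A (TFVar X)) ->
  tail_of (TMu A) =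
  match tail_of (ty_open A (TFVar X)) with
  | Free n x => if Nat.eqb x X then Top else Free n x
  | t => t
  end.
Proof.
  intros HX HA HP. apply is_type_tail in HA. apply proper_tail in HP.
  unfold ty_open in *. rewrite tail_open_rec_var in *. simpl.
  destruct (tail_of A) as [|n x|[|n] [|j]|] eqn:E; simpl in *; auto; try tauto.
  - apply tail_free_in_fv in E. destruct (Nat.eqb_spec x X); subst; tauto.
  - now rewrite Nat.eqb_refl.
Qed.

(** Finished tails in the range of [s] hold no dangling index, so an enclosing [bind] leaves them
    alone. *)
Lemma tail_subst (s : nat -> ty) (A : ty) :
  (forall x, finished (tail_of (s x))) ->
  tail_of (ty_subst s A) =
  match tail_of A with
  | Free n x => delay n (tail_of (s x))
  | t => t
  end.
Proof.
  intros Hs; induction A; simpl; auto.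
  - destruct (tail_of (s n)); auto.
  - rewrite IHA. destruct (tail_of A); simpl; auto.
    destruct (tail_of (s n0)); auto.
  - rewrite IHA. destruct (tail_of A) as [|n x|[|n] [|j']|]; simpl; auto.
    specialize (Hs x). destruct (tail_of (s x)); simpl in *; tauto.
Qed.

(** * Substitution preserves type expressions *)

Lemma fresh_proper (X : nat) (A : ty) : ~ In X (ty_fv A) -> proper X A.
Proof.
  induction A; simpl; auto.
  rewrite in_app_iff. tauto.
Qed.

(** The final variable of the tail is bound, so the substitution never reaches the end of the
    tail. *)
Lemma top_variant_subst (s : nat -> ty) (A : ty) :
  top_variant A -> top_variant (ty_subst s A).
Proof.
  unfold top_variant. intros H.
  destruct (tail_var A) as [|j| | |] eqn:E; try tauto.
  assert (tail_var (ty_subst s A) = TBVar j /\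
          tail_spine (ty_subst s A) = tail_spine A) as [-> ->]; auto.
  clear H. induction A; simpl in *; try discriminate; auto;
    destruct IHA as [? ->]; auto.
Qed.

Lemma proper_subst (s : nat -> ty) (X X' : nat) (A : ty) :
  (forall y, In y (ty_fv A) -> y <> X -> ~ In X' (ty_fv (s y))) ->
  proper X A -> proper X' (ty_subst s A).
Proof.
  induction A; simpl; intros Hs HP; auto.
  - apply fresh_proper. auto.
  - destruct HP as [[H1 H2]|HP]; [left|right; now apply top_variant_subst].
    split; [apply IHA1|apply IHA2]; auto; intros; apply Hs; auto using in_or_app.
  - destruct HP as [H1|HP]; [left; auto|right].
    now apply (top_variant_subst s) in HP.
Qed.

Lemma proper_open_subst (s : nat -> ty) (X X' : nat) (A : ty) :
  (forall x, ty_closed 0 (s x)) ->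
  ~ In X (ty_fv A) -> ~ In X' (ty_fv (ty_subst s A)) ->
  proper X (ty_open A (TFVar X)) ->
  proper X' (ty_open (ty_subst s A) (TFVar X')).
Proof.
  intros Hs HX HX' HP.
  rewrite <- (ty_subst_open_update s A (TFVar X') X); simpl; auto.
  apply (proper_subst _ X); auto. intros y Hy Hn.
  rewrite update_neq by auto. intros Hin. apply HX'.
  apply (in_fv_ty_subst s A y); auto.
  apply in_fv_ty_open in Hy. destruct Hy as [Hy|[Hy|[]]]; congruence.
Qed.

Lemma is_type_update (s : nat -> ty) (X : nat) (U : ty) :
  (forall x, is_type (s x)) -> is_type U -> forall x, is_type (update s X U x).
Proof. intros Hs HU x. unfold update. destruct (Nat.eqb x X); auto. Qed.

Lemma is_type_subst (A : ty) : is_type A -> forall s,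
  (forall x, is_type (s x)) -> is_type (ty_subst s A).
Proof.
  induction 1 as [x|A B|A|A X HX HA IH HP]; simpl; intros s Hs;
    try (constructor; auto; fail); auto.
  destruct (exists_fresh (ty_fv (ty_subst s A))) as [X' HX'].
  assert (Hc : forall x, ty_closed 0 (s x)) by (intros; apply is_type_closed; auto).
  assert (~ In X' (ty_fv (ty_subst s A))) by (intros H; apply HX' in H; lia).
  apply it_mu with X'; auto.
  - rewrite <- (ty_subst_open_update s A (TFVar X') X); simpl; auto.
    apply IH, is_type_update; auto.
  - eapply proper_open_subst; eauto.
Qed.

Lemma is_type_open (A U : ty) (X : nat) :
  ~ In X (ty_fv A) -> is_type (ty_open A (TFVar X)) -> is_type U ->
  is_type (ty_open A U).
Proof.
  intros HX HA HU. rewrite <- (ty_subst_open_single A U X);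
    auto using is_type_closed.
  apply is_type_subst, is_type_update; auto.
Qed.

Lemma is_type_unfold (A : ty) : is_type (TMu A) -> is_type (ty_open A (TMu A)).
Proof. intros H. inversion H; subst. eapply is_type_open; eauto. Qed.

Lemma is_type_top : is_type top.
Proof.
  apply it_mu with 0; simpl; auto.
Qed.

(** * Equality of types *)

Lemma teq_is_type (d : bool) (A B : ty) : teq d A B -> is_type A /\ is_type B.
Proof.
  induction 1; repeat match goal with H : _ /\ _ |- _ => destruct H end;
    split; auto using is_type_top, is_type_unfold.
  econstructor; eauto.
Qed.

Lemma is_type_finished (s : nat -> ty) :
  (forall x, is_type (s x)) -> forall x, finished (tail_of (s x)).
Proof. auto using is_type_tail. Qed.

Lemma tail_open (A U : ty) (X : nat) :
  ~ In X (ty_fv A) -> is_type U ->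
  tail_of (ty_open A U) =
  match tail_of (ty_open A (TFVar X)) with
  | Free n x => if Nat.eqb x X then delay n (tail_of U) else Free n x
  | t => t
  end.
Proof.
  intros HX HU. rewrite <- (ty_subst_open_single A U X); auto using is_type_closed.
  rewrite tail_subst.
  - destruct (tail_of (ty_open A (TFVar X))); auto. unfold update.
    destruct (Nat.eqb n0 X); auto. simpl. now rewrite Nat.add_0_r.
  - apply is_type_finished, is_type_update; auto.
Qed.

Lemma delay_fixed (n : nat) (t : tail) : n <> 0 -> finished t -> t = delay n t -> t = Top.
Proof.
  destruct t; simpl; intros Hn Hf H; auto; try tauto. injection H; lia.
Qed.

(** The delicate rule is the fixed-point rule. If the tail of [C] is [X] behind [n] bullets,
    properness gives [n > 0], and the tail of [A] is unchanged by [n] further bullets. A finite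
    count of bullets cannot satisfy this, so it is [Top], as is that of [TMu C]. *)
Lemma tail_teq (d : bool) (A B : ty) : teq d A B -> tail_of A = tail_of B.
Proof.
  induction 1 as [| | |A B H IH|A B C D H1 IH1 H2 IH2|A HA|A HA|A C X HX HC HP H IH|];
    simpl; auto; try congruence.
  - inversion HA as [| | |? X HX HC HP]; subst.
    change (bind (tail_of A)) with (tail_of (TMu A)).
    rewrite (tail_open A (TMu A) X), (tail_mu A X); auto.
    destruct (tail_of (ty_open A (TFVar X))); auto. destruct (Nat.eqb n0 X); auto.
  - change (bind (tail_of C)) with (tail_of (TMu C)).
    apply teq_is_type in H. destruct H as [HA _].
    rewrite (tail_open C A X) in IH by auto. rewrite (tail_mu C X) by auto.
    apply proper_tail in HP.
    destruct (tail_of (ty_open C (TFVar X))) as [|n x| |]; auto.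
    destruct (Nat.eqb_spec x X); auto; subst.
    apply (delay_fixed n); auto using is_type_tail.
Qed.

Lemma teq_subst (d : bool) (A B : ty) : teq d A B -> forall s,
  (forall x, is_type (s x)) -> teq d (ty_subst s A) (ty_subst s B).
Proof.
  induction 1 as [A HA|A B H IH|A B C H1 IH1 H2 IH2|A B H IH|A B C D H1 IH1 H2 IH2
                 |A HA|A HA|A C X HX HC HP H IH|A B Hd HA HB]; simpl; intros s Hs;
    auto using is_type_subst.
  - apply teq_sym; auto.
  - eapply teq_trans; eauto.
  - apply teq_top. auto using is_type_subst.
  - unfold ty_open. rewrite ty_subst_open_rec by auto using is_type_closed.
    apply (teq_unfold d (ty_subst s A)).
    apply (is_type_subst (TMu A)); auto.
  - assert (HM : is_type (ty_subst s (TMu C))).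
    { apply is_type_subst; auto. econstructor; eauto. }
    simpl in HM. inversion HM; subst.
    eapply teq_fix; eauto.
    unfold ty_open in *. rewrite <- ty_subst_open_rec by auto using is_type_closed.
    auto.
Qed.

Lemma teq_mu (d : bool) (A B : ty) (X : nat) :
  ~ In X (ty_fv A) -> ~ In X (ty_fv B) ->
  proper X (ty_open A (TFVar X)) -> proper X (ty_open B (TFVar X)) ->
  teq d (ty_open A (TFVar X)) (ty_open B (TFVar X)) -> teq d (TMu A) (TMu B).
Proof.
  intros HA HB PA PB H. destruct (teq_is_type _ _ _ H) as [TA TB].
  assert (TM : is_type (TMu A)) by (econstructor; eauto).
  apply teq_fix with X; auto.
  eapply teq_trans; [apply teq_unfold; auto|].
  rewrite <- (ty_subst_open_single A _ X), <- (ty_subst_open_single B _ X);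
    auto using is_type_closed.
  apply teq_subst; auto. apply is_type_update; auto.
Qed.

Lemma teq_subst_congr (d : bool) (A : ty) : is_type A -> forall s t,
  (forall x, teq d (s x) (t x)) -> teq d (ty_subst s A) (ty_subst t A).
Proof.
  induction 1 as [x|A B|A|A X HX HA IH HP]; simpl; intros s t Hst;
    auto.
  assert (Hs : forall x, ty_closed 0 (s x))
    by (intros x; apply is_type_closed, (teq_is_type d _ _ (Hst x))).
  assert (Ht : forall x, ty_closed 0 (t x))
    by (intros x; apply is_type_closed, (teq_is_type d _ _ (Hst x))).
  destruct (exists_fresh (ty_fv (ty_subst s A) ++ ty_fv (ty_subst t A))) as [X' HX'].
  assert (~ In X' (ty_fv (ty_subst s A)) /\ ~ In X' (ty_fv (ty_subst t A))) as [F1 F2].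
  { split; intros F; apply (Nat.lt_irrefl X'), HX', in_or_app; auto. }
  apply teq_mu with X'; eauto using proper_open_subst.
  rewrite <- (ty_subst_open_update s A (TFVar X') X),
    <- (ty_subst_open_update t A (TFVar X') X); simpl; auto.
  apply IH. intros x. unfold update. destruct (Nat.eqb x X); auto.
Qed.

(** The substitution is there for the recursive case: with [top] put for the bound variable the body
    equals [top], so [top] solves the fixed-point equation and hence equals the recursive type. *)
Lemma teq_top_of_tail (d : bool) (A : ty) : is_type A -> forall s,
  (forall x, is_type (s x)) ->
  match tail_of A with
  | Top => True
  | Free _ x => teq d (s x) top
  | _ => False
  end -> teq d (ty_subst s A) top.
Proof.
  induction 1 as [x|A B HA IHA HB IHB|A HA IH|A X HX HA IH HP]; intros s Hs H; simpl in *; auto.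
  - eapply teq_trans; [apply teq_arr|apply teq_top];
      eauto using is_type_subst.
  - eapply teq_trans with (TLater top).
    + apply teq_later, IH; auto. destruct (tail_of A); simpl in H; auto.
    + apply teq_sym, (teq_unfold d (TLater (TBVar 0))), is_type_top.
  - assert (TM : is_type (ty_subst s (TMu A))).
    { apply is_type_subst; auto. econstructor; eauto. }
    simpl in TM. inversion TM as [| | |? X' HX' HA' HP']; subst.
    apply teq_sym, teq_fix with X'; auto. apply teq_sym.
    rewrite <- (ty_subst_open_update s A top X);
      auto using is_type_closed, is_type_top.
    apply IH; [apply is_type_update; auto using is_type_top|].
    change (bind (tail_of A)) with (tail_of (TMu A)) in H.
    rewrite (tail_mu A X) in H by auto.
    destruct (tail_of (ty_open A (TFVar X))); auto. unfold update.
    destruct (Nat.eqb n0 X); auto using teq_refl, is_type_top.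
Qed.

Lemma tail_top_teq (d : bool) (A : ty) :
  is_type A -> tail_of A = Top -> teq d A top.
Proof.
  intros HA H. rewrite <- (ty_subst_id A).
  apply teq_top_of_tail; auto. now rewrite H.
Qed.

(** * Head forms *)

(* Bullets in front of an arrow are pushed inside it; those in front of a
   variable are dropped, since [tail_of] records them. *)
Inductive head : ty -> ty -> Prop :=
| head_var : forall x, head (TFVar x) (TFVar x)
| head_arr : forall A B, head (TArr A B) (TArr A B)
| head_later_var : forall A x, head A (TFVar x) -> head (TLater A) (TFVar x)
| head_later_arr : forall A B C, head A (TArr B C) ->
    head (TLater A) (TArr (TLater B) (TLater C))
| head_mu : forall A H, head (ty_open A (TMu A)) H -> head (TMu A) H.

Lemma head_unique (A H K : ty) : head A H -> head A K -> H = K.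
Proof.
  intros HH; revert K; induction HH; intros K HK; inversion HK; subst; auto;
    match goal with HA : head ?A _ |- _ => specialize (IHHH _ HA) end; congruence.
Qed.

Lemma head_is_type (A H : ty) : head A H -> is_type A -> is_type H.
Proof.
  induction 1 as [| |A x H IH|A B C H IH|A K H IH]; intros HA; auto.
  - inversion HA; subst. specialize (IH H1). inversion IH; auto.
  - apply IH, is_type_unfold; auto.
Qed.

Lemma head_var_tail (A : ty) (x : nat) :
  head A (TFVar x) -> is_type A -> exists n, tail_of A = Free n x.
Proof.
  intros H; remember (TFVar x) as K eqn:E; revert x E.
  induction H as [z|A B|A y H IH|A B C H IH|A K H IH]; intros x E HA; subst; try discriminate.
  - injection E as ->. exists 0; auto.
  - injection E as ->. inversion HA; subst. destruct (IH x) as [n Hn]; auto.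
    simpl. rewrite Hn. simpl; eauto.
  - destruct (IH x) as [n Hn]; auto using is_type_unfold.
    exists n. rewrite <- Hn. apply (tail_teq true), teq_unfold; auto.
Qed.

(** A variable head has to be fixed by [s], since its image could have any head form or none. *)
Lemma head_subst (s : nat -> ty) (A H : ty) :
  (forall x, ty_closed 0 (s x)) -> head A H ->
  (forall x, H = TFVar x -> s x = TFVar x) -> head (ty_subst s A) (ty_subst s H).
Proof.
  intros Hs; induction 1 as [x| |A x HA IH|A B C HA IH|A K HA IH]; intros Hv; simpl.
  - rewrite (Hv x); auto using head_var.
  - apply head_arr.
  - rewrite (Hv x); auto. apply head_later_var. simpl in IH. rewrite <- (Hv x); auto.
  - apply head_later_arr, IH. discriminate.
  - apply head_mu. unfold ty_open in *.
    specialize (IH Hv). rewrite ty_subst_open_rec in IH; auto.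
Qed.

Lemma head_open (A U H : ty) (X : nat) :
  ~ In X (ty_fv A) -> ty_closed 0 U -> head (ty_open A (TFVar X)) H ->
  H <> TFVar X -> head (ty_open A U) (ty_subst (update TFVar X U) H).
Proof.
  intros HX HU HH HN. rewrite <- (ty_subst_open_single A U X) by auto.
  apply head_subst; auto.
  - intros y. unfold update. destruct (Nat.eqb y X); simpl; auto.
  - intros y ->. apply update_neq. congruence.
Qed.

(* Properness leaves at least one bullet in front of [X], so that closing the
   tail [X] with [mu] produces a variant of [top]. *)
Lemma tail_mu_head_var (A : ty) (X : nat) :
  ~ In X (ty_fv A) -> is_type (ty_open A (TFVar X)) ->
  proper X (ty_open A (TFVar X)) -> head (ty_open A (TFVar X)) (TFVar X) ->
  tail_of (TMu A) = Top.
Proof.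
  intros HX HA HP H. rewrite (tail_mu A X) by auto.
  destruct (head_var_tail _ _ H) as [n ->]; auto. now rewrite Nat.eqb_refl.
Qed.

Lemma var_dec (H : ty) (X : nat) : H = TFVar X \/ H <> TFVar X.
Proof.
  destruct H as [x| | | |]; try (right; discriminate).
  destruct (Nat.eq_dec x X); [left|right]; congruence.
Qed.

(** Unfolding does not shrink a type, so the induction follows the formation of [A]. The head of the
    body opened at a fresh [X] survives the substitution of the recursive type for [X], unless it is
    [X] itself; in that case the tail is [Top]. *)
Lemma head_exists (A : ty) : is_type A -> tail_of A = Top \/ exists H, head A H.
Proof.
  induction 1 as [x|A B|A HA IH|A X HX HA IH HP]; eauto using head.
  - destruct IH as [IH|[H IH]]; [left; simpl; now rewrite IH|right].
    pose proof (head_is_type _ _ IH HA) as HH.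
    assert (is_type H /\ match H with TFVar _ | TArr _ _ => True | _ => False end) as [_ E].
    { split; auto. clear -IH. induction IH; auto. }
    destruct H; try tauto; eauto using head.
  - destruct IH as [IH|[H IH]].
    + left. rewrite (tail_mu A X), IH; auto.
    + destruct (var_dec H X) as [->|N].
      * left. eapply tail_mu_head_var; eauto.
      * right. eexists. apply head_mu. eapply head_open; eauto.
        apply is_type_closed. econstructor; eauto.
Qed.

Inductive head_eq : ty -> ty -> Prop :=
| head_eq_var : forall x, head_eq (TFVar x) (TFVar x)
| head_eq_arr : forall A B C D, teq true A C -> teq true B D ->
    head_eq (TArr A B) (TArr C D).

Lemma head_shape (A H : ty) : head A H -> is_type A ->
  (exists x, H = TFVar x) \/
  (exists B C, H = TArr B C /\ is_type B /\ is_type C).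
Proof.
  intros HH HA. pose proof (head_is_type _ _ HH HA) as TH. clear HA.
  induction HH; eauto.
  - right. inversion TH; eauto 6.
  - right. inversion TH; eauto 6.
Qed.

Lemma head_eq_refl (A H : ty) : head A H -> is_type A -> head_eq H H.
Proof.
  intros HH HA. destruct (head_shape _ _ HH HA) as [[x ->]|(B & C & -> & HB & HC)];
    constructor; auto.
Qed.

Lemma teq_head (A B : ty) : teq true A B ->
  tail_of A = Top \/ exists H K, head A H /\ head B K /\ head_eq H K.
Proof.
  induction 1 as [A HA|A B H IH|A B C H1 IH1 H2 IH2|A B H IH|A B C D H1 IH1 H2 IH2
                 |A HA|A HA|A C X HX HC HP H IH|A B Hd HA HB].
  - destruct (head_exists A HA) as [E|[H E]]; auto.
    right. exists H, H. eauto using head_eq_refl.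
  - destruct IH as [IH|(K & L & HK & HL & E)].
    + apply tail_teq in H. left; congruence.
    + right. exists L, K. repeat split; auto. destruct E; constructor; auto.
  - destruct IH1 as [IH1|(K & L & HK & HL & E)]; auto.
    destruct IH2 as [IH2|(L' & M & HL' & HM & E')].
    + apply tail_teq in H1. left; congruence.
    + rewrite (head_unique _ _ _ HL' HL) in E'. right. exists K, M. repeat split; auto.
      destruct E; inversion E'; subst; constructor; eauto using teq_trans.
  - destruct IH as [IH|(K & L & HK & HL & E)].
    + left. simpl. now rewrite IH.
    + right. destruct E; do 2 eexists; repeat split;
        eauto using head_later_var, head_later_arr; constructor; auto.
  - right. do 2 eexists; repeat split; try apply head_arr. constructor; auto.
  - left; auto.
  - destruct (head_exists _ HA) as [E|[H E]]; auto.
    right. exists H, H. inversion E; subst. repeat split; auto.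
    apply (head_eq_refl (TMu A)); auto.
  - pose proof (teq_fix _ _ _ _ HX HC HP H) as HF.
    destruct (teq_is_type _ _ _ HF) as [HA HM].
    destruct IH as [IH|(K & L & HK & HL & E)]; auto.
    (* [J] is the head of [C] at the variable [X]. When it is not [X], the heads of [C] at [A] and
       of [TMu C] are two instances of [J], which agree because [A] and [TMu C] are already known to
       be equal. *)
    destruct (head_exists _ HC) as [T|[J HJ]].
    + left. rewrite (tail_teq _ _ _ HF), (tail_mu C X), T; auto.
    + destruct (var_dec J X) as [->|N].
      * left. rewrite (tail_teq _ _ _ HF). eapply tail_mu_head_var; eauto.
      * right. pose proof (head_open _ A _ _ HX (is_type_closed _ HA) HJ N) as H1.
        pose proof (head_open _ _ _ _ HX (is_type_closed _ HM) HJ N) as H2.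
        rewrite (head_unique _ _ _ HL H1) in E.
        exists K, (ty_subst (update TFVar X (TMu C)) J).
        repeat split; auto using head_mu.
        assert (Hu : forall x, teq true (update TFVar X A x) (update TFVar X (TMu C) x)).
        { intros x. unfold update. destruct (Nat.eqb x X); auto. }
        destruct (head_shape _ _ HJ HC) as [[x ->]|(J1 & J2 & -> & T1 & T2)]; simpl in *.
        -- rewrite update_neq in * by congruence. auto.
        -- inversion E; subst. constructor; eapply teq_trans; eauto;
             apply teq_subst_congr; auto.
  - right. do 2 eexists; repeat split; [apply head_later_arr, head_arr|apply head_arr|].
    constructor; auto.
Qed.

(** * Subtyping *)

Definition laters (n : nat) (A : ty) : ty := Nat.iter n TLater A.

Lemma laters_later (n : nat) (A : ty) : laters n (TLater A) = TLater (laters n A).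
Proof. symmetry. apply Nat.iter_succ_r. Qed.

Lemma laters_add (n m : nat) (A : ty) : laters n (laters m A) = laters (n + m) A.
Proof. symmetry. apply Nat.iter_add. Qed.

Lemma is_type_laters (n : nat) (A : ty) : is_type A -> is_type (laters n A).
Proof. intros H. induction n; simpl; auto. Qed.

Lemma ty_subst_laters (s : nat -> ty) (n : nat) (A : ty) :
  ty_subst s (laters n A) = laters n (ty_subst s A).
Proof. induction n; simpl; congruence. Qed.

Lemma sassm_wf_incl (g h : sassm) :
  (forall X Y, g X Y -> h X Y) -> sassm_wf h -> sassm_wf g.
Proof. intros H [H1 H2]. split; eauto. Qed.

Lemma sub_wf (g : sassm) (A B : ty) : sub g A B -> sassm_wf g.
Proof.
  induction 1; auto. eapply sassm_wf_incl; [|eassumption].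
  intros U V HUV. apply H1; auto.
Qed.

Lemma sub_is_type (g : sassm) (A B : ty) : sub g A B -> is_type A /\ is_type B.
Proof.
  induction 1 as [| |g A B Hw H| | | |g g' A B X Y HXA HYB Hu Hw H IH HX1 HX2 HY1 HY2 PA PB|];
    repeat match goal with H : _ /\ _ |- _ => destruct H end;
    try (apply teq_is_type in H); auto using is_type_top.
  split; econstructor; eauto.
Qed.

Lemma sub_refl (g : sassm) (A : ty) : sassm_wf g -> is_type A -> sub g A A.
Proof. intros; apply sub_sim; [auto|apply teq_refl; auto]. Qed.

Lemma sassm_union_incl (g h : sassm) :
  (forall X Y, g X Y -> h X Y) -> sassm_union g h h.
Proof. split; [auto|intros []; auto]. Qed.

(* Composition with reflexivity under the larger assumption. *)
Lemma sub_weaken (g h : sassm) (A B : ty) :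
  (forall X Y, g X Y -> h X Y) -> sassm_wf h -> sub g A B -> sub h A B.
Proof.
  intros Hi Hw H. apply (sub_trans g h h A B B); auto using sassm_union_incl.
  apply sub_refl; auto. apply (sub_is_type _ _ _ H).
Qed.

Lemma sub_compose (g : sassm) (A B C : ty) : sub g A B -> sub g B C -> sub g A C.
Proof.
  intros H1 H2. apply (sub_trans g g g A B C); eauto using sub_wf, sassm_union_incl.
Qed.

Lemma sub_laters (g : sassm) (n : nat) (A B : ty) :
  sub g A B -> sub g (laters n A) (laters n B).
Proof. intros H. induction n; simpl; auto using sub_later. Qed.

(** Assumptions are encoded as predicates; this bound supplies names outside them. *)
Definition sassm_fin (g : sassm) : Prop := exists N, forall Z, in_FTV Z g -> Z < N.

Definition extend (g : sassm) (X Y : nat) : sassm :=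
  fun U V => g U V \/ sassm_single X Y U V.

Lemma sassm_union_single_fin (g g' : sassm) (X Y : nat) :
  sassm_union g (sassm_single X Y) g' -> sassm_fin g -> sassm_fin g'.
Proof.
  intros Hu [N HN]. exists (S (N + X + Y)). intros Z [W [H|H]]; apply Hu in H;
    destruct H as [H|[-> ->]]; try lia;
    assert (Z < N) by (apply HN; exists W; auto); lia.
Qed.

Lemma extend_wf (g : sassm) (X Y : nat) :
  sassm_wf g -> X <> Y -> ~ in_FTV X g -> ~ in_FTV Y g -> sassm_wf (extend g X Y).
Proof.
  intros [H1 H2] HN HX HY.
  assert (F : forall U V, g U V -> U <> X /\ V <> X /\ U <> Y /\ V <> Y).
  { intros U V H. unfold in_FTV in *.
    repeat split; intros ->; [apply HX|apply HX|apply HY|apply HY]; eauto. }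
  split.
  - intros U V [H|[-> ->]]; auto.
  - intros U V U' V' [H|[-> ->]] [H'|[-> ->]] E; auto.
    + apply F in H. intuition congruence.
    + apply F in H'. intuition congruence.
Qed.

(** Each assumed pair is replaced by a derivation under [h]. At a mu rule the two bound variables
    are renamed apart from [h] and from the substituted bodies, and [h] is extended by the renamed
    pair. *)
Lemma sub_subst (g : sassm) (A B : ty) : sub g A B -> forall s h,
  (forall x, is_type (s x)) -> sassm_wf h -> sassm_fin h ->
  (forall X Y, g X Y -> sub h (s X) (s Y)) -> sub h (ty_subst s A) (ty_subst s B).
Proof.
  induction 1 as [g X Y Hw H|g A Hw HA|g A B Hw H|g1 g2 g A B C H1 IH1 H2 IH2 Hu Hw
    |g A B H IH|g1 g2 g A A' B B' H1 IH1 H2 IH2 Hu Hw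
    |g g' A B X Y HXA HYB Hu Hw H IH HX1 HX2 HY1 HY2 PA PB|g A Hw HA];
    intros s h Hs Hwh Hfh Hg; simpl.
  - auto.
  - apply sub_top; auto using is_type_subst.
  - apply sub_sim; auto. apply teq_subst; auto.
  - apply sub_compose with (ty_subst s B); [apply IH1|apply IH2]; auto;
      intros U V HUV; apply Hg, Hu; auto.
  - apply sub_later; auto.
  - apply sub_arr with h h; auto using sassm_union_incl; [apply IH1|apply IH2]; auto;
      intros U V HUV; apply Hg, Hu; auto.
  - assert (HXY : X <> Y) by (apply Hw, Hu; right; split; auto).
    assert (Hc : forall x, ty_closed 0 (s x)) by auto using is_type_closed.
    destruct Hfh as [N HN].
    destruct (exists_fresh (ty_fv (ty_subst s A) ++ ty_fv (ty_subst s B))) as [M HM].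
    (* [N] bounds the names in [h] and [M] those in both substituted bodies. *)
    set (X' := N + M). set (Y' := S (N + M)).
    assert (FA : forall Z, N + M <= Z -> ~ In Z (ty_fv (ty_subst s A))).
    { intros Z HZ F. specialize (HM Z (in_or_app _ _ _ (or_introl F))). lia. }
    assert (FB : forall Z, N + M <= Z -> ~ In Z (ty_fv (ty_subst s B))).
    { intros Z HZ F. specialize (HM Z (in_or_app _ _ _ (or_intror F))). lia. }
    assert (Fh : forall Z, N + M <= Z -> ~ in_FTV Z h).
    { intros Z HZ F. apply HN in F. lia. }
    assert (Hw' : sassm_wf (extend h X' Y')).
    { apply extend_wf; auto; try apply Fh; subst X' Y'; lia. }
    assert (HYA : ~ In Y (ty_fv A)) by (intros F; apply HY2, in_fv_ty_open_r; auto).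
    assert (HXB : ~ In X (ty_fv B)) by (intros F; apply HX2, in_fv_ty_open_r; auto).
    apply sub_mu with (extend h X' Y') X' Y';
      try (apply FA; subst X' Y'; lia); try (apply FB; subst X' Y'; lia);
      try (apply Fh; subst X' Y'; lia); auto.
    + intros U V; reflexivity.
    + set (s' := update (update s X (TFVar X')) Y (TFVar Y')).
      assert (EA : ty_subst s' (ty_open A (TFVar X))
                   = ty_open (ty_subst s A) (TFVar X')).
      { rewrite <- (ty_subst_open_update s A (TFVar X') X); simpl; auto.
        apply ty_subst_ext. intros x Hx. apply update_neq. intros ->; auto. }
      assert (EB : ty_subst s' (ty_open B (TFVar Y))
                   = ty_open (ty_subst s B) (TFVar Y')).
      { rewrite <- (ty_subst_open_update s B (TFVar Y') Y); simpl; auto.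
        apply ty_subst_ext. intros x Hx. unfold s', update.
        destruct (Nat.eqb x Y); auto. destruct (Nat.eqb_spec x X); auto.
        subst; tauto. }
      rewrite <- EA, <- EB. apply IH; auto.
      * apply is_type_update; auto. apply is_type_update; auto.
      * apply (sassm_union_single_fin h _ X' Y'); [intros U V; reflexivity|].
        exists N; auto.
      * intros U V HUV. apply Hu in HUV. destruct HUV as [HUV|[-> ->]].
        -- assert (U <> X /\ V <> X /\ U <> Y /\ V <> Y) as (N1 & N2 & N3 & N4).
           { unfold in_FTV in *. repeat split; intros ->;
               [apply HX1|apply HX1|apply HY1|apply HY1]; eauto. }
           unfold s'. rewrite !update_neq by auto.
           apply (sub_weaken h); auto. intros; left; auto.
        -- unfold s'. rewrite update_eq, update_neq, update_eq by auto.
           apply sub_assm; auto. right; split; auto.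
    + intros F. apply in_fv_ty_open in F. destruct F as [F|[F|[]]].
      * revert F. apply FB. subst X'; lia.
      * subst X' Y'; lia.
    + intros F. apply in_fv_ty_open in F. destruct F as [F|[F|[]]].
      * revert F. apply FA. subst Y'; lia.
      * subst X' Y'; lia.
    + apply proper_open_subst with X; auto.
    + apply proper_open_subst with Y; auto. apply FB; subst Y'; lia.
  - apply sub_next; auto using is_type_subst.
Qed.

(** * Tails and head forms along subtyping *)

(** The bound variables occur in [g'] only in the discharged pair, so two related tail variables
    either end in [Y] or are related outside the binders. *)
Lemma mu_assm_vars (g g' : sassm) (X Y U V : nat) :
  sassm_union g (sassm_single X Y) g' -> sassm_wf g' ->
  ~ in_FTV X g -> ~ in_FTV Y g -> U <> Y -> V <> X ->
  (U = V \/ g' U V) -> (V = Y) \/ (U <> X /\ (U = V \/ g U V)).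
Proof.
  intros Hu Hw HX HY HU HV [->|H]; auto.
  apply Hu in H. destruct H as [H|[-> ->]]; auto.
  right. split; auto. intros ->. apply HX. exists V; auto.
Qed.

(** The bullet counts [n] and [m] are left unrelated: only the final variables are compared. *)
Lemma tail_sub (g : sassm) (A B : ty) : sub g A B ->
  tail_of B = Top \/
  exists n m X Y, tail_of A = Free n X /\ tail_of B = Free m Y /\ (X = Y \/ g X Y).
Proof.
  induction 1 as [g X Y Hw H|g A Hw HA|g A B Hw H|g1 g2 g A B C H1 IH1 H2 IH2 Hu Hw
    |g A B H IH|g1 g2 g A A' B B' H1 IH1 H2 IH2 Hu Hw
    |g g' A B X Y HXA HYB Hu Hw H IH HX1 HX2 HY1 HY2 PA PB|g A Hw HA].
  - right. simpl. eauto 10.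
  - auto.
  - destruct (teq_is_type _ _ _ H) as [HA _]. apply tail_teq in H. rewrite <- H.
    apply is_type_tail in HA. destruct (tail_of A); simpl in HA; try tauto.
    right. eauto 10.
  - destruct IH2 as [IH2|(n & m & X & Y & E1 & E2 & E3)]; auto.
    destruct IH1 as [IH1|(n' & m' & X' & Y' & F1 & F2 & F3)]; [congruence|].
    right. rewrite E1 in F2. injection F2 as <- <-.
    exists n', m, X', Y. repeat split; auto.
    destruct E3 as [<-|E3].
    + destruct F3; auto. right; apply Hu; auto.
    + right. destruct F3 as [->|F3]; [apply Hu; auto|].
      (* A chain of two assumed pairs would use its middle variable twice, which a well-formed
         assumption forbids. *)
      exfalso. destruct Hw as [W1 W2].
      assert (G1 : g X' X) by (apply Hu; auto). assert (G2 : g X Y) by (apply Hu; auto).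
      apply (W1 _ _ G2). destruct (W2 _ _ _ _ G1 G2); auto.
  - destruct IH as [IH|(n & m & X & Y & E1 & E2 & E3)]; simpl.
    + rewrite IH; auto.
    + rewrite E1, E2. right. simpl. eauto 10.
  - simpl. destruct IH2 as [IH2|(n & m & X & Y & E1 & E2 & E3)]; auto.
    right. exists n, m, X, Y. repeat split; auto.
    destruct E3; auto. right; apply Hu; auto.
  - destruct (sub_is_type _ _ _ H) as [TA TB].
    rewrite (tail_mu A X), (tail_mu B Y) by auto.
    destruct IH as [->|(n & m & U & V & E1 & E2 & E3)]; auto.
    rewrite E1, E2.
    assert (NU : U <> Y) by (intros ->; apply HY2; eapply tail_free_in_fv; eauto).
    assert (NV : V <> X) by (intros ->; apply HX2; eapply tail_free_in_fv; eauto).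
    destruct (Nat.eqb_spec V Y) as [->|N]; auto.
    destruct (mu_assm_vars g g' X Y U V) as [?|[N' E]]; auto; [tauto|].
    apply Nat.eqb_neq in N' as ->. right. eauto 10.
  - apply is_type_tail in HA. simpl.
    destruct (tail_of A); simpl in *; try tauto. right; eauto 10.
Qed.

(** One [k] serves both components, since [A <= .A] delays a whole arrow. Which variables can be
    paired is already settled by [tail_sub]. *)
Inductive head_sub (g : sassm) : ty -> ty -> Prop :=
| head_sub_var : forall x y, head_sub g (TFVar x) (TFVar y)
| head_sub_arr : forall A B C D k,
    sub g C (laters k A) -> sub g (laters k B) D ->
    head_sub g (TArr A B) (TArr C D).

Lemma sub_head (g : sassm) (A B : ty) : sub g A B -> sassm_fin g ->
  tail_of B = Top \/ exists H K, head A H /\ head B K /\ head_sub g H K.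
Proof.
  induction 1 as [g X Y Hw H|g A Hw HA|g A B Hw H|g1 g2 g A B C H1 IH1 H2 IH2 Hu Hw
    |g A B H IH|g1 g2 g A A' B B' H1 IH1 H2 IH2 Hu Hw
    |g g' A B X Y HXA HYB Hu Hw H IH HX1 HX2 HY1 HY2 PA PB|g A Hw HA]; intros Hf.
  - right. do 2 eexists; repeat split; constructor.
  - auto.
  - rewrite <- (tail_teq _ _ _ H). destruct (teq_head _ _ H) as [E|(K & L & HK & HL & E)]; auto.
    right. exists K, L. repeat split; auto. destruct E.
    + constructor.
    + apply (head_sub_arr g _ _ _ _ 0); apply sub_sim; unfold ty_sim; simpl; auto.
  - assert (I1 : forall U V, g1 U V -> g U V) by (intros; apply Hu; auto).
    assert (I2 : forall U V, g2 U V -> g U V) by (intros; apply Hu; auto).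
    assert (Hf1 : sassm_fin g1).
    { destruct Hf as [N HN]. exists N. intros Z [W HZ]. apply HN. exists W.
      destruct HZ; auto. }
    assert (Hf2 : sassm_fin g2).
    { destruct Hf as [N HN]. exists N. intros Z [W HZ]. apply HN. exists W.
      destruct HZ; auto. }
    (* Either [C] has tail [Top], or the tail of the middle type is a free variable; this excludes
       the [Top] alternative for the first premise. *)
    destruct (tail_sub _ _ _ H2) as [T|(? & ? & ? & ? & T & _)]; auto.
    destruct (IH2 Hf2) as [?|(L' & M & HL' & HM & E')]; auto.
    destruct (IH1 Hf1) as [?|(K & L & HK & HL & E)]; [congruence|].
    rewrite (head_unique _ _ _ HL' HL) in E'.
    right. exists K, M. repeat split; auto.
    destruct E as [|A1 A2 B1 B2 k S1 S2]; inversion E' as [|? ? C1 C2 k' S1' S2']; subst.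
    + constructor.
    + apply (head_sub_arr g _ _ _ _ (k' + k)); rewrite <- laters_add.
      * apply (sub_trans g2 g1 g _ (laters k' B1) _); auto using sub_laters.
        intros U V; specialize (Hu U V); tauto.
      * apply (sub_trans g1 g2 g _ (laters k' B2) _); auto using sub_laters.
  - destruct IH as [IH|(K & L & HK & HL & E)]; auto.
    + left. simpl. now rewrite IH.
    + right. destruct E as [|A1 A2 B1 B2 k S1 S2].
      * do 2 eexists; repeat split; eauto using head_later_var; constructor.
      * do 2 eexists; repeat split; eauto using head_later_arr.
        apply (head_sub_arr g _ _ _ _ k); rewrite laters_later; auto using sub_later.
  - right. do 2 eexists; repeat split; try apply head_arr.
    apply (head_sub_arr g _ _ _ _ 0);
      [apply (sub_weaken g1)|apply (sub_weaken g2)]; auto; intros; apply Hu; auto.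
  - assert (HM : sub g (TMu A) (TMu B)) by (eapply sub_mu; eauto).
    destruct (sub_is_type _ _ _ H) as [TA TB].
    destruct (sub_is_type _ _ _ HM) as [TMA TMB].
    assert (HXY : X <> Y) by (apply Hw, Hu; right; split; auto).
    assert (HYA : ~ In Y (ty_fv A)) by (intros F; apply HY2, in_fv_ty_open_r; auto).
    assert (HXB : ~ In X (ty_fv B)) by (intros F; apply HX2, in_fv_ty_open_r; auto).
    destruct (IH (sassm_union_single_fin _ _ _ _ Hu Hf)) as [T|(K & L & HK & HL & E)].
    { left. rewrite (tail_mu B Y), T; auto. }
    (* Under [s] the opened bodies become the unfoldings, and the assumption [X <= Y] becomes
       [HM]. *)
    set (s := update (update TFVar X (TMu A)) Y (TMu B)).
    assert (Hs : forall x, is_type (s x)).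
    { apply is_type_update; auto. apply is_type_update; auto. }
    assert (EA : ty_subst s (ty_open A (TFVar X)) = ty_open A (TMu A)).
    { rewrite <- (ty_subst_open_single A (TMu A) X) by auto using is_type_closed.
      apply ty_subst_ext. intros x Hx. apply update_neq. intros ->; auto. }
    assert (EB : ty_subst s (ty_open B (TFVar Y)) = ty_open B (TMu B)).
    { rewrite <- (ty_subst_open_single B (TMu B) Y) by auto using is_type_closed.
      apply ty_subst_ext. intros x Hx. unfold s, update.
      destruct (Nat.eqb x Y); auto. destruct (Nat.eqb_spec x X); auto.
      subst; tauto. }
    destruct (var_dec L Y) as [->|NL].
    { left. apply tail_mu_head_var with Y; auto. }
    (* If [K] were [X], its partner in the assumption would force [L] to be [Y], a case already
       settled. *)
    assert (HsK : forall x, K = TFVar x -> s x = TFVar x).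
    { intros x ->. inversion E as [? y|]; subst.
      destruct (head_var_tail _ _ HK) as [n Ex]; auto.
      destruct (head_var_tail _ _ HL) as [m Ey]; auto.
      assert (NU : x <> Y) by (intros ->; apply HY2; eapply tail_free_in_fv; eauto).
      assert (NV : y <> X) by (intros ->; apply HX2; eapply tail_free_in_fv; eauto).
      destruct (tail_sub _ _ _ H) as [T|(? & ? & U & V & T1 & T2 & T3)]; [congruence|].
      rewrite T1 in Ex. rewrite T2 in Ey. injection Ex as -> ->. injection Ey as -> ->.
      destruct (mu_assm_vars g g' X Y x y) as [->|[N' _]]; auto; [tauto|].
      unfold s. now rewrite !update_neq. }
    assert (HsL : forall y, L = TFVar y -> s y = TFVar y).
    { intros y ->. destruct (head_var_tail _ _ HL) as [m Ey]; auto.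
      assert (y <> X) by (intros ->; apply HX2; eapply tail_free_in_fv; eauto).
      unfold s. rewrite !update_neq; auto; congruence. }
    right. exists (ty_subst s K), (ty_subst s L). split; [|split].
    + apply head_mu. rewrite <- EA. apply head_subst; auto using is_type_closed.
    + apply head_mu. rewrite <- EB. apply head_subst; auto using is_type_closed.
    + assert (Hg : forall U V, g' U V -> sub g (s U) (s V)).
      { intros U V HUV. apply Hu in HUV. destruct HUV as [HUV|[-> ->]].
        - assert (U <> X /\ V <> X /\ U <> Y /\ V <> Y) as (N1 & N2 & N3 & N4).
          { unfold in_FTV in *. repeat split; intros ->;
              [apply HX1|apply HX1|apply HY1|apply HY1]; eauto. }
          unfold s. rewrite !update_neq by auto.
          apply sub_assm; auto. eapply sub_wf; eauto.
        - unfold s. rewrite update_eq, update_neq, update_eq by auto. auto. }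
      assert (Hsub : forall C D, sub g' C D -> sub g (ty_subst s C) (ty_subst s D)).
      { intros C D HCD. eapply sub_subst; eauto. eapply sub_wf; eauto. }
      destruct E as [x y|A1 A2 B1 B2 k S1 S2]; simpl.
      * rewrite (HsK x), (HsL y) by auto. constructor.
      * apply (head_sub_arr g _ _ _ _ k); rewrite <- ty_subst_laters; auto.
  - destruct (head_exists _ HA) as [T|[H HH]].
    + left. simpl. now rewrite T.
    + right. destruct (head_shape _ _ HH HA) as [[x ->]|(B & C & -> & HB & HC)].
      * do 2 eexists; repeat split; eauto using head_later_var; constructor.
      * do 2 eexists; repeat split; eauto using head_later_arr.
        (* The rule [A <= .A] is the source of a nonzero delay. *)
        apply (head_sub_arr g _ _ _ _ 1); apply sub_refl; simpl; auto.
Qed.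

(** * Substitution in terms *)

Fixpoint tm_subst (s : nat -> tm) (t : tm) : tm :=
  match t with
  | fvar x => s x
  | bvar n => bvar n
  | lam t1 => lam (tm_subst s t1)
  | app t1 t2 => app (tm_subst s t1) (tm_subst s t2)
  end.

Fixpoint tm_closed (k : nat) (t : tm) : Prop :=
  match t with
  | fvar _ => True
  | bvar n => n < k
  | lam t1 => tm_closed (S k) t1
  | app t1 t2 => tm_closed k t1 /\ tm_closed k t2
  end.

Lemma tm_closed_open_inv (t u : tm) : forall k,
  tm_closed k (tm_open_rec k u t) -> tm_closed (S k) t.
Proof.
  induction t; simpl; intros k H; auto.
  - destruct (Nat.eqb_spec k n); simpl in H; lia.
  - destruct H; split; auto.
Qed.

Lemma lc_closed (t : tm) : lc t -> tm_closed 0 t.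
Proof.
  induction 1; simpl; auto. eapply tm_closed_open_inv; eassumption.
Qed.

Lemma tm_open_closed (t u : tm) : forall j k,
  tm_closed j t -> j <= k -> tm_open_rec k u t = t.
Proof.
  induction t; simpl; intros j k H Hjk; auto.
  - destruct (Nat.eqb_spec k n); auto; lia.
  - f_equal. eapply IHt; [eassumption|lia].
  - destruct H; f_equal; eauto.
Qed.

Lemma tm_subst_open_rec (s : nat -> tm) (t u : tm) :
  (forall x, lc (s x)) -> forall k,
  tm_subst s (tm_open_rec k u t) = tm_open_rec k (tm_subst s u) (tm_subst s t).
Proof.
  intros Hs; induction t; simpl; intros k; auto; try (f_equal; auto; fail).
  - symmetry. eapply tm_open_closed; [apply lc_closed, Hs|lia].
  - destruct (Nat.eqb k n); auto.
Qed.

Lemma tm_subst_ext (s r : nat -> tm) (t : tm) :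
  (forall x, In x (tm_fv t) -> s x = r x) -> tm_subst s t = tm_subst r t.
Proof.
  induction t; simpl; intros H; auto; f_equal; auto;
    [apply IHt1|apply IHt2]; intros; apply H, in_or_app; auto.
Qed.

Lemma tm_subst_id (t : tm) : tm_subst fvar t = t.
Proof. induction t; simpl; congruence. Qed.

Lemma in_fv_tm_open_rec (t u : tm) (x : nat) : forall k,
  In x (tm_fv (tm_open_rec k u t)) -> In x (tm_fv t) \/ In x (tm_fv u).
Proof.
  induction t; simpl; intros k H; auto.
  - destruct (Nat.eqb k n); auto.
  - eauto.
  - apply in_app_or in H. rewrite in_app_iff.
    destruct H as [H|H]; [apply IHt1 in H|apply IHt2 in H]; tauto.
Qed.

Lemma in_fv_tm_open_r (t u : tm) (x : nat) : forall k,
  In x (tm_fv t) -> In x (tm_fv (tm_open_rec k u t)).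
Proof.
  induction t; simpl; intros k H; auto; try tauto.
  rewrite in_app_iff in *. destruct H; auto.
Qed.

Lemma lc_update (s : nat -> tm) (x : nat) (u : tm) :
  (forall y, lc (s y)) -> lc u -> forall y, lc (update s x u y).
Proof. intros Hs Hu y. unfold update. destruct (Nat.eqb y x); auto. Qed.

Lemma tm_subst_open_update (s : nat -> tm) (t u : tm) (x : nat) :
  (forall y, lc (s y)) -> lc u -> ~ In x (tm_fv t) ->
  tm_subst (update s x u) (tm_open t (fvar x)) = tm_open (tm_subst s t) u.
Proof.
  intros Hs Hu Hx. unfold tm_open. rewrite tm_subst_open_rec by auto using lc_update.
  simpl. rewrite update_eq. f_equal. apply tm_subst_ext.
  intros y Hy. apply update_neq. intros ->; auto.
Qed.

Lemma tm_subst_open_single (t u : tm) (x : nat) :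
  lc u -> ~ In x (tm_fv t) ->
  tm_subst (update fvar x u) (tm_open t (fvar x)) = tm_open t u.
Proof.
  intros Hu Hx. rewrite tm_subst_open_update; auto using lc_var.
  now rewrite tm_subst_id.
Qed.

Lemma fresh_notin (l : list nat) : exists x, ~ In x l.
Proof.
  destruct (exists_fresh l) as [x Hx]. exists x. intros H. apply Hx in H. lia.
Qed.

Lemma lc_subst (t : tm) : lc t -> forall s, (forall x, lc (s x)) -> lc (tm_subst s t).
Proof.
  induction 1 as [x|t x Hx Ht IH|t1 t2]; simpl; intros s Hs; auto using lc_app.
  destruct (fresh_notin (tm_fv (tm_subst s t))) as [y Hy].
  apply lc_lam with y; auto.
  rewrite <- (tm_subst_open_update s t (fvar y) x); auto using lc_var, lc_update.
Qed.

Lemma lc_open (t u : tm) : lc (lam t) -> lc u -> lc (tm_open t u).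
Proof.
  intros Ht Hu. inversion Ht; subst.
  rewrite <- (tm_subst_open_single t u x) by auto.
  apply lc_subst; auto using lc_update, lc_var.
Qed.

Lemma beta_lc (t u : tm) : beta t u -> lc t /\ lc u.
Proof.
  induction 1; repeat match goal with H : _ /\ _ |- _ => destruct H end;
    split; eauto using lc_app, lc_lam, lc_open.
Qed.

Lemma beta_fv (t u : tm) (x : nat) : beta t u -> In x (tm_fv u) -> In x (tm_fv t).
Proof.
  induction 1 as [t u Ht Hu|t t' u H IH Hu|t u u' Ht H IH|t t' y Hy Hy' H IH]; simpl;
    rewrite ?in_app_iff; try tauto.
  - apply in_fv_tm_open_rec.
  - intros Hx. apply (in_fv_tm_open_r _ (fvar y) _ 0) in Hx as Hx'.
    apply IH, in_fv_tm_open_rec in Hx'.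
    destruct Hx' as [?|[<-|[]]]; tauto.
Qed.

(** Serves to rename the fresh name of a reduction under [lam] to the one of the typing
    derivation. *)
Lemma beta_subst (t u : tm) : beta t u -> forall s, (forall x, lc (s x)) ->
  beta (tm_subst s t) (tm_subst s u).
Proof.
  induction 1 as [t u Ht Hu|t t' u H IH Hu|t u u' Ht H IH|t t' y Hy Hy' H IH];
    simpl; intros s Hs; auto using beta_app1, beta_app2, lc_subst.
  - unfold tm_open. rewrite tm_subst_open_rec by auto.
    apply beta_red; auto using lc_subst. apply (lc_subst (lam t)); auto.
  - destruct (fresh_notin (tm_fv (tm_subst s t) ++ tm_fv (tm_subst s t'))) as [z Hz].
    rewrite in_app_iff in Hz.
    apply beta_lam with z; try tauto.
    rewrite <- (tm_subst_open_update s t (fvar z) y),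
      <- (tm_subst_open_update s t' (fvar z) y); auto using lc_var, lc_update.
Qed.

(** * Typing *)

Lemma typed_lc (G : ctx) (M : tm) (A : ty) : typed G M A -> lc M.
Proof. induction 1; eauto using lc. Qed.

Lemma typing_context_incl (G H : ctx) :
  (forall x A, G x = Some A -> H x = Some A) ->
  typing_context H -> typing_context G.
Proof.
  intros Hi [[n Hn] HT]. split; [|eauto].
  exists n. intros x Hx. destruct (G x) as [A|] eqn:E; auto.
  apply Hi in E. rewrite Hn in E by auto. discriminate.
Qed.

Lemma typing_context_later (G : ctx) : typing_context G -> typing_context (ctx_later G).
Proof.
  unfold ctx_later. intros [[n Hn] HT]. split.
  - exists n. intros x Hx. now rewrite Hn.
  - intros x A H. destruct (G x) as [B|] eqn:E; [|discriminate].
    injection H as <-. eauto.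
Qed.

Lemma typing_context_update (G : ctx) (x : nat) (A : ty) :
  typing_context G -> is_type A -> typing_context (update G x (Some A)).
Proof.
  intros [[n Hn] HT] HA. split.
  - exists (S (n + x)). intros y Hy. rewrite update_neq by lia. apply Hn; lia.
  - intros y B. unfold update. destruct (Nat.eqb y x); [|eauto].
    intros [= <-]; auto.
Qed.

Lemma ctx_single_eq (x y : nat) (A B : ty) :
  ctx_single x A y = Some B <-> y = x /\ B = A.
Proof.
  unfold ctx_single. destruct (Nat.eqb_spec y x); split; intros H; try easy.
  - split; congruence.
  - destruct H; congruence.
Qed.

Lemma ctx_later_eq (G : ctx) (x : nat) (A : ty) :
  ctx_later G x = Some A <-> exists B, G x = Some B /\ A = TLater B.
Proof.
  unfold ctx_later. destruct (G x) as [B|]; simpl; split.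
  - intros [= <-]; eauto.
  - intros (C & [= ->] & ->); auto.
  - discriminate.
  - intros (C & [=] & _).
Qed.

Lemma typing_context_union_single (G G' : ctx) (x : nat) (A : ty) :
  ctx_union G (ctx_single x A) G' -> typing_context G -> is_type A ->
  typing_context G'.
Proof.
  intros Hu HG HA. apply (typing_context_incl _ (update G x (Some A)));
    auto using typing_context_update.
  intros y B HB. unfold update. destruct (Nat.eqb_spec y x) as [->|N].
  - assert (G' x = Some A) by (apply Hu; right; apply ctx_single_eq; auto). congruence.
  - apply Hu in HB. rewrite ctx_single_eq in HB. tauto.
Qed.

Lemma typing_context_union_l (G1 G2 G : ctx) :
  ctx_union G1 G2 G -> typing_context G -> typing_context G1.
Proof. intros Hu. apply typing_context_incl. intros x A H. apply Hu; auto. Qed.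

Lemma typing_context_union_r (G1 G2 G : ctx) :
  ctx_union G1 G2 G -> typing_context G -> typing_context G2.
Proof. intros Hu. apply typing_context_incl. intros x A H. apply Hu; auto. Qed.

#[local] Hint Resolve typing_context_later typing_context_update
  typing_context_union_single typing_context_union_l typing_context_union_r : core.

Lemma typed_is_type (G : ctx) (M : tm) (A : ty) :
  typed G M A -> typing_context G -> is_type A.
Proof.
  induction 1 as [G x A H|G M A H IH|G M H|G M A B H IH HS|G G' M A B x Hx HA Hu H IH
                 |G1 G2 G M N A B H1 IH1 H2 IH2 Hu]; intros HG.
  - destruct HG as [_ HG]; eauto.
  - specialize (IH (typing_context_later _ HG)). now inversion IH.
  - apply is_type_top.
  - apply (sub_is_type _ _ _ HS).
  - eauto.
  - assert (T : is_type (TArr A B)) by eauto. now inversion T.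
Qed.

Lemma sassm_wf_empty : sassm_wf sassm_empty.
Proof. split; [intros ? ? []|intros ? ? ? ? []]. Qed.

Lemma sassm_fin_empty : sassm_fin sassm_empty.
Proof. exists 0. intros Z [W [[]|[]]]. Qed.

#[local] Hint Resolve sassm_wf_empty sassm_fin_empty : core.

Lemma subtype_teq (A B : ty) : teq true A B -> subtype A B.
Proof. intros H. apply sub_sim; auto. Qed.

Lemma subtype_trans (A B C : ty) : subtype A B -> subtype B C -> subtype A C.
Proof. apply sub_compose. Qed.

Lemma subtype_laters_r (A : ty) (n : nat) : is_type A -> subtype A (laters n A).
Proof.
  intros HA. induction n; simpl.
  - apply sub_refl; auto.
  - eapply subtype_trans; [eassumption|].
    apply sub_next; auto using is_type_laters.
Qed.

Lemma laters_arr (A B : ty) (n : nat) : is_type A -> is_type B ->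
  teq true (laters n (TArr A B)) (TArr (laters n A) (laters n B)).
Proof.
  intros HA HB. induction n; simpl; auto.
  eapply teq_trans; [apply teq_later; eassumption|].
  apply teq_distr; auto using is_type_laters.
Qed.

(** The converse of the shift rule is admissible. Distribution of the bullet over arrows is used in
    both directions: outwards after an abstraction, inwards before an application. *)
Lemma typed_later (G : ctx) (M : tm) (A : ty) :
  typed G M A -> typing_context G -> typed (ctx_later G) M (TLater A).
Proof.
  induction 1 as [G x A H|G M A H IH|G M H|G M A B H IH HS|G G' M A B x Hx HA Hu H IH
                 |G1 G2 G M N A B H1 IH1 H2 IH2 Hu]; intros HG.
  - apply T_var, ctx_later_eq; eauto.
  - apply T_shift; auto.
  - apply T_sub with top; [apply T_top; auto|].
    apply sub_next; auto using is_type_top.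
  - apply T_sub with (TLater A); auto. apply sub_later; auto.
  - assert (HG' : typing_context G') by eauto.
    apply T_sub with (TArr (TLater A) (TLater B)).
    + apply T_abs with (ctx_later G') x; auto.
      intros y C. rewrite !ctx_later_eq, ctx_single_eq. split.
      * intros (D & HD & ->). apply Hu in HD. rewrite ctx_single_eq in HD.
        destruct HD as [HD|[-> ->]]; eauto.
      * intros [(D & HD & ->)|[-> ->]].
        -- exists D; split; auto. apply Hu; auto.
        -- exists A; split; auto. apply Hu; right. apply ctx_single_eq; auto.
    + apply subtype_teq, teq_sym, teq_distr; auto. eapply typed_is_type; eauto.
  - assert (HG1 : typing_context G1) by eauto.
    assert (HG2 : typing_context G2) by eauto.
    assert (T : is_type (TArr A B)) by (eapply typed_is_type; eauto).
    inversion T; subst.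
    apply T_app with (ctx_later G1) (ctx_later G2) (TLater A); auto.
    + eapply T_sub; [apply IH1; auto|]. apply subtype_teq, teq_distr; auto.
    + intros x C. rewrite !ctx_later_eq. split.
      * intros (D & HD & ->). apply Hu in HD. destruct HD; eauto.
      * intros [(D & HD & ->)|(D & HD & ->)]; exists D; split; auto; apply Hu; auto.
Qed.

(* [P] is a notion of typing for the substituted terms: variables first, which
   gives renaming and weakening, and then arbitrary typed terms. *)
Lemma typed_subst_gen (P : ctx -> tm -> ty -> Prop) :
  (forall G M A, P G M A -> typed G M A) ->
  (forall G x A, G x = Some A -> P G (fvar x) A) ->
  (forall G H M A, (forall x B, G x = Some B -> H x = Some B) -> typing_context H ->
     P G M A -> P H M A) ->
  (forall G M A, typing_context G -> P G M A -> P (ctx_later G) M (TLater A)) ->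
  forall G M A, typed G M A -> forall s H,
  (forall x, lc (s x)) -> typing_context H ->
  (forall x B, G x = Some B -> P H (s x) B) -> typed H (tm_subst s M) A.
Proof.
  intros P_typed P_var P_incl P_later.
  induction 1 as [G x A E|G M A HM IH|G M HM|G M A B HM IH HS|G G' M A B x Hx HA Hu HM IH
                 |G1 G2 G M N A B H1 IH1 H2 IH2 Hu]; intros s H Hs HH HP; simpl.
  - auto.
  - apply T_shift, IH; auto.
    intros x B HB. apply ctx_later_eq in HB. destruct HB as (C & HC & ->). auto.
  - apply T_top, lc_subst; auto.
  - apply T_sub with A; auto.
  - destruct HH as [[n Hn] HT].
    (* The name [x] may be declared in [H] or occur in the substituted terms, so the abstraction is
       retyped with a name [y] outside the domain of [H]. *)
    destruct (exists_fresh (n :: tm_fv (tm_subst s M))) as [y Hy].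
    assert (HHy : H y = None) by (apply Hn, Nat.lt_le_incl, Hy; left; auto).
    assert (HH : typing_context H) by (split; eauto).
    apply T_abs with (update H y (Some A)) y; auto.
    + intros F. specialize (Hy y (or_intror F)). lia.
    + intros z C. rewrite ctx_single_eq. unfold update.
      destruct (Nat.eqb_spec z y) as [->|N].
      * rewrite HHy. split; [intros [= <-]; auto|]. intros [|[_ ->]]; congruence.
      * tauto.
    + rewrite <- (tm_subst_open_update s M (fvar y) x) by auto using lc_var.
      apply IH; auto using lc_update, lc_var.
      intros z C HC. unfold update at 2. destruct (Nat.eqb_spec z x) as [->|N].
      * assert (G' x = Some A) by (apply Hu; right; apply ctx_single_eq; auto).
        apply P_var. rewrite update_eq. congruence.
      * apply Hu in HC. rewrite ctx_single_eq in HC.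
        destruct HC as [HC|[? _]]; [|tauto].
        apply (P_incl H); auto. intros w D HD. rewrite update_neq; auto. congruence.
  - apply T_app with H H A; [apply IH1|apply IH2|]; auto;
      try (intros x C HC; apply HP, Hu; auto).
    intros x C; tauto.
Qed.

(** A name chosen at an abstraction may clash with the larger context, so weakening is obtained
    together with renaming, at the identity substitution. *)
Lemma typed_weaken (G H : ctx) (M : tm) (A : ty) :
  (forall x B, G x = Some B -> H x = Some B) -> typing_context H ->
  typed G M A -> typed H M A.
Proof.
  intros Hi HH HM. rewrite <- (tm_subst_id M).
  apply (typed_subst_gen (fun G M A => exists x, M = fvar x /\ G x = Some A)) with G;
    eauto using lc_var.
  - intros G' M' A' (x & -> & E). apply T_var; auto.
  - intros G' H' M' A' HI _ (x & -> & E). eauto.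
  - intros G' M' A' _ (x & -> & E). exists x. split; auto.
    apply ctx_later_eq; eauto.
Qed.

Lemma typed_subst (G H : ctx) (M : tm) (A : ty) (s : nat -> tm) :
  typed G M A -> (forall x, lc (s x)) -> typing_context H ->
  (forall x B, G x = Some B -> typed H (s x) B) -> typed H (tm_subst s M) A.
Proof.
  intros HM Hs HH HT.
  apply (typed_subst_gen typed) with G; auto using T_var, typed_later.
  intros G' H' M' A' HI HH'. apply typed_weaken; auto.
Qed.

(** * Iterated delays and the contraction of a redex *)

Definition ctx_laters (n : nat) (G : ctx) : ctx := Nat.iter n ctx_later G.

Lemma ctx_laters_eq (n : nat) (G : ctx) (x : nat) (A : ty) :
  ctx_laters n G x = Some A <-> exists B, G x = Some B /\ A = laters n B.
Proof.
  revert A; induction n; intros A; simpl.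
  - split; [eauto|]. intros (B & H & ->); auto.
  - rewrite ctx_later_eq. split.
    + intros (B & H & ->). apply IHn in H. destruct H as (C & H & ->). eauto.
    + intros (B & H & ->). exists (laters n B). split; auto. apply IHn; eauto.
Qed.

Lemma typing_context_laters (n : nat) (G : ctx) :
  typing_context G -> typing_context (ctx_laters n G).
Proof. intros H. induction n; simpl; auto. Qed.

Lemma typed_laters (n : nat) (G : ctx) (M : tm) (A : ty) :
  typed G M A -> typing_context G -> typed (ctx_laters n G) M (laters n A).
Proof.
  intros H HG. induction n; simpl; auto using typed_later, typing_context_laters.
Qed.

Lemma typed_shifts (n : nat) (G : ctx) (M : tm) (A : ty) :
  typed (ctx_laters n G) M (laters n A) -> typed G M A.
Proof. induction n; simpl; auto using T_shift. Qed.

Lemma tail_laters (n : nat) (A : ty) : tail_of (laters n A) = Top -> tail_of A = Top.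
Proof.
  induction n; simpl; auto. intros H. apply IHn.
  destruct (tail_of (laters n A)); simpl in H; auto; discriminate.
Qed.

Lemma typed_tail_top (G : ctx) (M : tm) (A : ty) :
  lc M -> is_type A -> tail_of A = Top -> typed G M A.
Proof.
  intros HM HA HT. apply T_sub with top; [apply T_top; auto|].
  apply subtype_teq, teq_sym, tail_top_teq; auto.
Qed.

(** Each shift rule adds one to [n], and each subsumption is composed with the subtyping after being
    delayed [n] times. The [Top] alternative starts at the rule for [top] and is preserved by
    both. *)
Lemma typed_lam_inv (G : ctx) (M : tm) (T : ty) :
  typed G (lam M) T -> typing_context G ->
  tail_of T = Top \/ exists n x A B G', ~ In x (tm_fv M) /\ is_type A /\
    ctx_union (ctx_laters n G) (ctx_single x A) G' /\
    typed G' (tm_open M (fvar x)) B /\ subtype (TArr A B) (laters n T).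
Proof.
  intros H. remember (lam M) as L eqn:E. revert M E.
  induction H as [G x A H|G L A H IH|G L H|G L A B H IH HS|G G' L A B x Hx HA Hu H IH
                 |G1 G2 G L N A B H1 IH1 H2 IH2 Hu]; intros M E HG; try discriminate.
  - destruct (IH M E) as [T|(n & x & B & C & G' & Hx & HB & Hu & HM & HS)]; auto.
    + left. apply (tail_laters 1); auto.
    + right. exists (S n), x, B, C, G'.
      unfold ctx_laters. rewrite Nat.iter_succ_r. simpl. rewrite <- laters_later. auto.
  - auto.
  - destruct (IH M E HG) as [T|(n & x & C & D & G' & Hx & HC & Hu & HM & HS')].
    + left. destruct (tail_sub _ _ _ HS) as [|(? & ? & ? & ? & T' & _)]; auto.
      congruence.
    + right. exists n, x, C, D, G'. repeat (split; auto).
      eapply subtype_trans; [eassumption|]. apply sub_laters; auto.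
  - injection E as ->. right. exists 0, x, A, B, G'. repeat (split; auto).
    apply sub_refl; auto. constructor; auto. eapply typed_is_type; eauto.
Qed.

(** The exception concerns [D] because an arrow has the tail of its codomain. *)
Lemma subtype_arr_inv (A B C D : ty) : subtype (TArr A B) (TArr C D) ->
  tail_of D = Top \/ exists k, subtype C (laters k A) /\ subtype (laters k B) D.
Proof.
  intros H. destruct (sub_head _ _ _ H) as [T|(K & L & HK & HL & E)]; auto.
  right. inversion HK; inversion HL; subst. inversion E; subst. eauto.
Qed.

Lemma typed_beta_red (G : ctx) (M N : tm) (A B : ty) :
  typing_context G -> typed G (lam M) (TArr A B) -> typed G N A ->
  typed G (tm_open M N) B.
Proof.
  intros HG HM HN.
  assert (LN : lc N) by (eapply typed_lc; eauto).
  assert (LM : lc (tm_open M N)) by (apply lc_open; auto; eapply typed_lc; eauto).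
  assert (T : is_type (TArr A B)) by (eapply typed_is_type; eauto).
  inversion T as [|? ? TA TB| |]; subst.
  destruct (typed_lam_inv _ _ _ HM HG)
    as [E|(n & x & C & D & G' & Hx & TC & Hu & HB & HS)];
    [apply typed_tail_top; auto|].
  pose proof (typing_context_laters n G HG) as HGn.
  (* The [n] bullets are pushed inside the arrow, so that two arrows are compared. *)
  pose proof (subtype_trans _ _ _ HS (subtype_teq _ _ (laters_arr A B n TA TB))) as HS'.
  apply subtype_arr_inv in HS'. destruct HS' as [E|(k & S1 & S2)].
  { apply tail_laters in E. apply typed_tail_top; auto. }
  apply (typed_shifts n). apply T_sub with (laters k D); auto.
  rewrite <- (tm_subst_open_single M N x) by auto.
  assert (HG' : typing_context G') by eauto.
  apply typed_subst with (ctx_laters k G'); auto using typed_laters, lc_update, lc_var.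
  intros y E HE. apply ctx_laters_eq in HE. destruct HE as (F & HF & ->).
  unfold update. destruct (Nat.eqb_spec y x) as [->|NE].
  - assert (G' x = Some C) by (apply Hu; right; apply ctx_single_eq; auto).
    assert (F = C) as -> by congruence.
    apply T_sub with (laters n A); auto using typed_laters.
  - apply T_sub with F.
    + apply T_var. apply Hu in HF. rewrite ctx_single_eq in HF. tauto.
    + apply subtype_laters_r. destruct HG' as [_ HG']; eauto.
Qed.

(** Induction on the typing derivation, since shift and subsumption leave the term unchanged; a
    redex at the root arises only at an application. *)
Theorem theorem7 : forall (G : ctx) (M L : tm) (A : ty),
  typing_context G -> typed G M A -> beta M L -> typed G L A.
Proof.
  intros G M L A HG H. revert L HG.
  induction H as [G x A H|G M A H IH|G M H|G M A B H IH HS|G G' M A B x Hx HA Hu H IH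
                 |G1 G2 G M N A B H1 IH1 H2 IH2 Hu]; intros L HG HR.
  - inversion HR.
  - apply T_shift; auto.
  - apply T_top. apply (beta_lc _ _ HR).
  - apply T_sub with A; auto.
  - inversion HR as [| | |t t' y Hy Hy' HR']; subst.
    assert (Hx' : ~ In x (tm_fv t')) by (intros F; apply Hx, (beta_fv _ _ x HR); auto).
    apply T_abs with G' x; auto. apply IH; eauto.
    (* The reduction of the body is given at [y] and its typing at [x]. *)
    rewrite <- (tm_subst_open_single M (fvar x) y),
      <- (tm_subst_open_single t' (fvar x) y); auto using lc_var.
    apply beta_subst; auto using lc_update, lc_var.
  - assert (HG1 : typing_context G1) by eauto.
    assert (HG2 : typing_context G2) by eauto.
    inversion HR as [t u Ht Hu'|t t' u HR' Hu'|t u u' Ht HR'|]; subst.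
    + apply typed_beta_red with A; auto.
      (* Function and argument are moved to the common context [G], as contraction is stated over a
         single one. *)
      * apply typed_weaken with G1; auto. intros x C HC. apply Hu; auto.
      * apply typed_weaken with G2; auto. intros x C HC. apply Hu; auto.
    + apply T_app with G1 G2 A; auto.
    + apply T_app with G1 G2 A; auto.
Qed.
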